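(* Assume that for every group $g\in\mathcal G$, $U_g(t_g^{\max})\ge U_g^\star>0$. Let $\hat U_g^-(t,\alpha)$ be a point-wise lower confidence bound on $U_g(t)$, i.e. for any $g\in\mathcal G$, $t\in\{0,1,\dots,t_g^{\max}-1\}$ and $\alpha\in(0,1)$, $\Pr\big(U_g(t)\ge \hat U_g^-(t,\alpha)\big)\ge 1-\alpha$; and let $\hat U_g^+(t,\alpha)$ be a point-wise upper confidence bound on $U_g(t)$, i.e. for any $g\in\mathcal G$, $t\in\{1,\dots,t_g^{\max}-1\}$ and $\alpha\in(0,1)$, $\Pr\big(U_g(t)\le \hat U_g^+(t,\alpha)\big)\ge 1-\alpha$. Define $$\hat t_g^{\mathrm{mono}} := \min\Big\{t\in\{1,\dots,t_g^{\max}-1\} : \hat U_g^-(t',\alpha)\ge U_g^\star \ \text{ for all integers } t' \text{ with } t\le t'<t_g^{\max}\Big\},$$ where the minimum over the empty set is defined to be $t_g^{\max}$. Then for any group $g\in\mathcal G$ and any $\alpha\in(0,1)$, with probability at least $1-\alpha$, $$U_g\big(\hat t_g^{\mathrm{mono}}\big)-U_g^\star < \hat U_g^+\Big(\hat t_g^{\mathrm{mono}},\tfrac{\alpha}{t_g^{\max}-1}\Big)-\hat U_g^-\big(\hat t_g^{\mathrm{mono}}-1,\alpha\big).$$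
   Context: There are $n$ items $d^1,\dots,d^n$ in an item space $\mathcal D$, and a family $\mathcal G$ of (possibly overlapping) groups of items. A recommendation request is a pair $(q,\mathbf r)$ drawn from a distribution $P_{Q,\mathbf R}$, where $q\in\mathcal Q$ is a query and $\mathbf r=(r^1,\dots,r^n)\in\{0,1\}^n$ is the vector of relevances of the items. A relevance model $f:\mathcal Q\times\mathcal D\to[0,1]$ is fixed. For a query $q$ and group $g$, $\sigma_{q,g}^f$ is a deterministic ranking of the items of $g$ by their estimated relevance $f(q,\cdot)$ (highest first); $\sigma_{q,g}^f(j)$ is the index of the item of $g$ ranked at position $j$. For each $g$, the positive integer $t_g^{\max}$ is the largest candidate-set size considered for $g$, and $U_g^\star\in\mathbb R$ is a target. For an integer $t$ with $0\le t\le t_g^{\max}$, $$U_g(t):=\mathbb E_{(q,\mathbf r)\sim P_{Q,\mathbf R}}\Big[\sum_{j=1}^{t} r^{\sigma_{q,g}^f(j)}\Big]$$ is the expected number of relevant items among the $t$ top-scored items of $g$. The confidence bounds $\hat U_g^-(t,\alpha)$ and $\hat U_g^+(t,\alpha)$ are random real quantities (computed from random data), and probabilities are over their randomness. In $U_g(\hat t)$ with $\hat t$ random, the deterministic function $U_g$ is evaluated at the random integer $\hat t$.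
   Formalization: The claim fails as stated; it is proved under two added assumptions: almost surely Û⁻(0,α) ≤ U(0) for all α in (0,1), and almost surely U(t_max) ≤ Û⁺(t_max, α/(t_max−1)) (level read as 0 if t_max = 1). *)

(* Defs.v *)
From HB Require Import structures.
From mathcomp Require Import all_boot all_order all_algebra.
From mathcomp Require Import all_classical all_reals all_analysis.

Set Implicit Arguments.
Unset Strict Implicit.
Unset Printing Implicit Defensive.

Import Order.TTheory GRing.Theory Num.Theory.

Local Open Scope classical_set_scope.
Local Open Scope ring_scope.

(* Items are represented by their indices in 'I_n and a group by the set of
   the indices of its items.  Positions are counted from 0: s j is the index
   of the item of g at position j.+1.  Injectivity and s j \in g together make
   s a bijection from positions onto g; how ties are broken is left open. *)
Definition is_ranking (R : realType) (n : nat) (score : 'I_n -> R)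
    (g : {set 'I_n}) (s : 'I_#|g| -> 'I_n) : Prop :=
  [/\ injective s,
      forall j, s j \in g &
      forall j k : 'I_#|g|, (j <= k)%N -> score (s k) <= score (s j)].

(* The real number U_g(t); the integrand lies between 0 and n, so that the
   expectation is finite and nothing is lost by [fine]. *)
Definition utility (R : realType) (d : measure_display) (Q : measurableType d)
    (n : nat) (PQR : probability (Q * n.-tuple bool)%type R)
    (g : {set 'I_n}) (sigma : Q -> 'I_#|g| -> 'I_n) (t : nat) : R :=
  fine 'E_PQR[(fun x : Q * n.-tuple bool =>
    \sum_(j < #|g| | (j < t)%N) (tnth x.2 (sigma x.1 j))%:R)].

(* min {t in {1, ..., tmax - 1} : Ustar <= lo t' whenever t <= t' < tmax}.
   All candidates t are smaller than tmax, hence the neutral element tmax only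
   shows up as the minimum of the empty set. *)
Definition t_mono (R : realType) (tmax : nat) (Ustar : R) (lo : nat -> R) :
    nat :=
  \big[minn/tmax]_(1 <= t < tmax |
     [forall t' : 'I_tmax, (t <= t')%N ==> (Ustar <= lo t')]) t.

(* Main.v *)
(* By minimality of t, either t = 1 or t - 1 fails the threshold test although
   every size from t on passes it; hence lo (t - 1) < Ustar, surely for t > 1
   and, because lo 0 <= U 0 = 0 < Ustar, almost surely for t = 1.  It remains
   to know that U t <= up t at the random t, which holds almost surely for
   t = tmax and otherwise follows from a union bound over 1, ..., tmax - 1, each
   value failing with probability at most alpha / (tmax - 1). *)
Require Import Defs.
From HB Require Import structures.
From mathcomp Require Import all_boot all_order all_algebra.
From mathcomp Require Import all_classical all_reals all_analysis.
From mathcomp Require Import measurable_realfun.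
From mathcomp Require Import zify lra.

Set Implicit Arguments.
Unset Strict Implicit.
Unset Printing Implicit Defensive.

Import Order.TTheory GRing.Theory Num.Theory.

Local Open Scope classical_set_scope.
Local Open Scope ring_scope.

(** The admissible sizes are closed upwards, so minimality needs testing at the predecessor only.
    This turns the minimum into threshold conditions on [lo]. *)
Lemma t_monoP (R : realType) (tmax : nat) (u : R) (lo : nat -> R) (t : nat) :
  (0 < tmax)%N ->
  t_mono tmax u lo = t <->
  [/\ (0 < t <= tmax)%N,
      forall s, (t <= s < tmax)%N -> u <= lo s &
      (1 < t)%N -> lo t.-1 < u].
Proof.
move=> tmax_gt0; pose ok t := [forall s : 'I_tmax, (t <= s)%N ==> (u <= lo s)].
have okP t' : ok t' <-> forall s, (t' <= s < tmax)%N -> u <= lo s.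
  split=> [/forallP h s /andP[ts slt]|h].
    by have /implyP := h (Ordinal slt); apply.
  by apply/forallP => s; apply/implyP => ts; apply: h; rewrite ts ltn_ord.
(* At [tmax] the condition is vacuous, so the default value of the minimum is itself admissible and
   needs no separate case. *)
have ok_tmax : ok tmax by apply/okP => s; lia.
have ok_pred t' : ok t'.+1 -> u <= lo t' -> ok t'.
  move=> /okP h ut'; apply/okP => s /andP[]; rewrite leq_eqVlt.
  by case/predU1P => [<- //|t's] st; apply: h; rewrite t's.
have [t0 okt] : (0 < t_mono tmax u lo <= tmax)%N /\ ok (t_mono tmax u lo).
  rewrite /t_mono big_seq_cond.
  elim/big_ind: _ => [|x y hx hy|i /andP[]]; rewrite ?tmax_gt0 ?leqnn//.
    by rewrite /minn; case: ifP.
  by rewrite mem_index_iota => /andP[-> /ltnW ->].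
have lb t' : (0 < t' <= tmax)%N -> ok t' -> (t_mono tmax u lo <= t')%N.
  move=> /andP[t'0]; rewrite leq_eqVlt => /predU1P[-> _|t'tmax okt'].
    by case/andP: t0.
  have : t' \in index_iota 1 tmax by rewrite mem_index_iota t'0.
  rewrite /t_mono; elim: (index_iota _ _) => //= i r IHr; rewrite big_cons inE.
  case/predU1P => [<-|/IHr le_t']; first by rewrite -/(ok t') okt' geq_minl.
  by case: ifP => // _; rewrite geq_min le_t' orbT.
split=> [<-|[t0' /okP okt' lot]].
  split=> //; first exact/okP.
  move=> t1; rewrite ltNge; apply/negP => ulo.
  set m := t_mono _ _ _ in t0 okt t1 ulo.
  have : (m <= m.-1)%N.
    by apply: lb; [lia | apply: ok_pred => //; rewrite prednK//; lia].
  lia.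
(* A minimum below [t] would be positive and at most [t.-1], forcing [1 < t] and [u <= lo t.-1]. *)
apply/eqP; rewrite eqn_leq lb//=; rewrite leqNgt; apply/negP => mt.
have := lot; rewrite ltNge => /(_ _)/negP; apply; first lia.
move/okP : okt; apply; lia.
Qed.

(** Passing from [A] to the intersection loses [A] minus [B], which lies in the complement of [B]
    and so has mass at most [b]. *)
Lemma probability_setI_ge (d : measure_display) (T : measurableType d)
    (R : realType) (P : probability T R) (A B : set T) (a b : R) :
  measurable A -> measurable B ->
  ((1 - a)%:E <= P A)%E -> ((1 - b)%:E <= P B)%E ->
  ((1 - (a + b))%:E <= P (A `&` B))%E.
Proof.
move=> mA mB.
have mAB : measurable (A `&` B) by exact: measurableI.
have mD : measurable (A `\` B) by exact: measurableD.
have : (P (A `\` B) <= P (~` B))%E.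
  by apply: le_measure; rewrite ?inE//; exact: measurableC.
have : P A = (P (A `\` B) + P (A `&` B))%E by exact: measureDI.
rewrite probability_setC//.
have PE X : measurable X -> P X = (fine (P X))%:E.
  by move=> mX; rewrite fineK ?fin_num_measure.
rewrite (PE _ mA) (PE _ mB) (PE _ mAB) (PE _ mD).
by rewrite -EFinD -EFinB !lee_fin => -[]; lra.
Qed.

(** Union bound for complements, by induction on the list. Hypotheses are restricted to members of
    [r] because [Uup_ucb] covers only [0 < t < tmax g]. *)
Lemma probability_bigsetI_ge (d : measure_display) (T : measurableType d)
    (R : realType) (P : probability T R) (I : eqType) (r : seq I)
    (A : I -> set T) (a : I -> R) :
  (forall i, i \in r -> measurable (A i)) ->
  (forall i, i \in r -> ((1 - a i)%:E <= P (A i))%E) ->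
  ((1 - \sum_(i <- r) a i)%:E <= P (\big[setI/setT]_(i <- r) A i))%E.
Proof.
elim: r => [|i r IHr] mA PA; first by rewrite !big_nil subr0 probability_setT.
have r_sub j : j \in r -> j \in i :: r by rewrite inE orbC => ->.
rewrite !big_cons; apply: probability_setI_ge.
- by apply: mA; rewrite mem_head.
- by rewrite big_seq; apply: bigsetI_measurable => j /r_sub /mA.
- by apply: PA; rewrite mem_head.
- by apply: IHr => j /r_sub; [exact: mA | exact: PA].
Qed.

Lemma utility0 (R : realType) (d : measure_display) (Q : measurableType d)
    (n : nat) (PQR : probability (Q * n.-tuple bool)%type R)
    (g : {set 'I_n}) (sigma : Q -> 'I_#|g| -> 'I_n) :
  utility PQR sigma 0 = 0.
Proof.
rewrite /utility (_ : (fun _ => _) = cst 0) ?expectation_cst//.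
by apply/funext => x; rewrite big_pred0.
Qed.

Lemma measurable_set_ler (d : measure_display) (T : measurableType d)
    (R : realType) (f g : T -> R) :
  measurable_fun setT f -> measurable_fun setT g ->
  measurable [set w | f w <= g w].
Proof.
by move=> mf mg; rewrite -[X in measurable X]setTI; exact: measurable_fun_le.
Qed.

Lemma measurable_set_ltr (d : measure_display) (T : measurableType d)
    (R : realType) (f g : T -> R) :
  measurable_fun setT f -> measurable_fun setT g ->
  measurable [set w | f w < g w].
Proof.
move=> mf mg; have -> : [set w | f w < g w] = ~` [set w | g w <= f w].
  by apply/seteqP; split=> w /=; rewrite ltNge => /negP.
by apply: measurableC; exact: measurable_set_ler.
Qed.

Lemma measurable_t_mono (R : realType) (d : measure_display)
    (T : measurableType d) (tmax : nat) (u : R) (lo : nat -> T -> R)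
    (t : nat) :
  (0 < tmax)%N -> (forall s, measurable_fun setT (lo s)) ->
  measurable [set w | t_mono tmax u (lo^~ w) = t].
Proof.
move=> tmax_gt0 mlo.
have mle s : measurable [set w | u <= lo s w].
  by apply: measurable_set_ler => //; exact: measurable_cst.
have mlt s : measurable [set w | lo s w < u].
  by apply: measurable_set_ltr => //; exact: measurable_cst.
have [tP|/negP tP] := boolP (0 < t <= tmax)%N; last first.
  have -> : [set w | t_mono tmax u (lo^~ w) = t] = set0.
    by apply/seteqP; split=> w //= /t_monoP[].
  exact: measurable0.
(* The second index set is empty or the singleton of [t.-1]; it encodes the implication from [1 < t]
   as an intersection. *)
have -> : [set w | t_mono tmax u (lo^~ w) = t] =
    \bigcap_(s in [set s | (t <= s < tmax)%N]) [set w | u <= lo s w] `&`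
    \bigcap_(s in [set s | (1 < t)%N /\ s = t.-1]) [set w | lo s w < u].
  apply/seteqP; split=> w /=; rewrite t_monoP//.
    by case=> _ ge_u lt_u; split=> // s [t1 ->]; exact: lt_u.
  by case=> ge_u lt_u; split=> // t1; apply: lt_u.
by apply: measurableI; apply: bigcap_measurableType.
Qed.

Theorem proposition4p4 (R : realType)
    (* items, groups, requests, relevance model *)
    (n : nat) (D : Type) (item : 'I_n -> D)
    (G : Type) (grp : G -> {set 'I_n})
    (dQ : measure_display) (Q : measurableType dQ)
    (PQR : probability (Q * n.-tuple bool)%type R)
    (f : Q -> D -> R) (f01 : forall q x, 0 <= f q x <= 1)
    (* the rankings sigma_{q,g}^f *)
    (sigma : forall g : G, Q -> 'I_#|grp g| -> 'I_n)
    (sigma_ranking : forall g q,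
       is_ranking (fun i => f q (item i)) (sigma g q))
    (sigma_measurable : forall g j i, measurable [set q | sigma g q j = i])
    (* candidate-set sizes and targets *)
    (tmax : G -> nat)
    (tmax_gt0 : forall g, (0 < tmax g)%N)
    (tmax_le : forall g, (tmax g <= #|grp g|)%N)
    (Ustar : G -> R)
    (Ustar_gt0 : forall g, 0 < Ustar g)
    (Ustar_le : forall g, Ustar g <= utility PQR (sigma g) (tmax g))
    (* confidence bounds *)
    (dO : measure_display) (Omega : measurableType dO)
    (P : probability Omega R)
    (Ulo Uup : G -> nat -> R -> {RV P >-> R})
    (Ulo_lcb : forall g t alpha, (t < tmax g)%N -> 0 < alpha < 1 ->
       ((1 - alpha)%:E <=
        P [set w | (Ulo g t alpha w <= utility PQR (sigma g) t)%R])%E)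
    (Uup_ucb : forall g t alpha, (0 < t < tmax g)%N -> 0 < alpha < 1 ->
       ((1 - alpha)%:E <=
        P [set w | (utility PQR (sigma g) t <= Uup g t alpha w)%R])%E)
    (* Additional hypotheses: the bounds at the two end points, where no
       estimation is needed (U_g 0 = 0 and U_g (tmax g) <= tmax g), are valid
       almost surely. Without them the conclusion may fail when the selected
       size is 1 or tmax g. *)
    (Ulo_0 : forall g alpha, 0 < alpha < 1 ->
       P [set w | Ulo g 0%N alpha w <= utility PQR (sigma g) 0] = 1%E)
    (Uup_tmax : forall g alpha, 0 < alpha < 1 ->
       P [set w | utility PQR (sigma g) (tmax g) <=
                  Uup g (tmax g) (alpha / ((tmax g)%:R - 1)) w] = 1%E)
    (g : G) (alpha : R) (alpha01 : 0 < alpha < 1) :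
  let that (w : Omega) : nat :=
    t_mono (tmax g) (Ustar g) (fun t => Ulo g t alpha w) in
  is_true ((1 - alpha)%:E <=
    P [set w | (utility PQR (sigma g) (that w) - Ustar g <
                Uup g (that w) (alpha / ((tmax g)%:R - 1)) w
                - Ulo g (that w).-1 alpha w)%R])%E.
Proof.
move=> that; set U := utility PQR (sigma g); set k := tmax g.
set beta := alpha / (k%:R - 1).
have mlo t : measurable_fun setT (Ulo g t alpha) by exact: measurable_funPT.
have mup t : measurable_fun setT (Uup g t beta) by exact: measurable_funPT.
pose V t := [set w | U t <= Uup g t beta w].
have mV t : measurable (V t).
  by apply: measurable_set_ler => //; exact: measurable_cst.
pose V0 := [set w | Ulo g 0%N alpha w <= U 0%N].
have mV0 : measurable V0.
  by apply: measurable_set_ler => //; exact: measurable_cst.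
pose good := V0 `&` (V k `&` \big[setI/setT]_(t <- index_iota 1 k) V t).
have mV1 : measurable (\big[setI/setT]_(t <- index_iota 1 k) V t).
  by apply: bigsetI_measurable.
have mgood : measurable good by do 2!apply: measurableI => //.
(* When [k = 1] the division gives [beta = 0], but the sum is then empty. *)
have P_good : ((1 - alpha)%:E <= P good)%E.
  have le_beta : \sum_(t <- index_iota 1 k) beta <= alpha.
    rewrite big_const_seq count_predT size_iota iter_addr_0 -mulr_natr.
    rewrite natrB ?tmax_gt0// /beta; have [->|k1] := eqVneq (k%:R - 1 : R) 0.
      by rewrite mulr0; case/andP: alpha01 => /ltW.
    by rewrite divfK.
  (* The two zeros are the failure probabilities of [V0] and [V k], so all of [alpha] is left for
     the sizes in between. *)
  have : ((1 - alpha)%:E <=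
      (1 - (0 + (0 + \sum_(t <- index_iota 1 k) beta)))%:E)%E.
    by rewrite lee_fin !add0r lerB.
  move/le_trans; apply.
  apply: probability_setI_ge => //; first exact: measurableI.
    by rewrite subr0 /V0 Ulo_0.
  apply: probability_setI_ge => //; first by rewrite subr0 /V Uup_tmax.
  apply: probability_bigsetI_ge => // t; rewrite mem_index_iota => /andP[t0 tk].
  apply: Uup_ucb; first by rewrite t0.
  (* The existence of [t] with [0 < t < k] forces [k >= 2], whence [0 < beta <= alpha < 1]. *)
  have k2 : 1 <= k%:R - 1 :> R.
    by rewrite lerBrDr -(natrD _ 1 1) ler_nat; lia.
  case/andP: alpha01 => a0 a1; rewrite divr_gt0 ?(lt_le_trans _ k2)//=.
  rewrite ltr_pdivrMr ?(lt_le_trans _ k2)// mul1r.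
  exact: lt_le_trans k2.
apply: (le_trans P_good); apply: le_measure; rewrite ?inE//.
  (* Slicing by the value of [that] makes the random index constant on each piece of a countable
     union. *)
  rewrite (_ : [set _ | _] = \bigcup_t ([set w | that w = t] `&`
      [set w | U t - Ustar g < Uup g t beta w - Ulo g t.-1 alpha w])).
    apply: bigcupT_measurable => t; apply: measurableI.
      exact: measurable_t_mono.
    apply: measurable_set_ltr; first exact: measurable_cst.
    exact: measurable_funB.
  apply/seteqP; split=> w /=; first by move=> h; exists (that w).
  by case=> t _ [/= ->].
move=> w [V0w [Vkw Vw]] /=.
have /t_monoP[//|/andP[t0 tk] _ lo_lt] := erefl (that w).
have Uup_w : U (that w) <= Uup g (that w) beta w.
  move: tk; rewrite leq_eqVlt => /predU1P[->//|tk].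
  move: Vw; rewrite -bigcap_seq => /(_ (that w)); apply.
  by rewrite /= mem_index_iota t0.
have Ulo_w : Ulo g (that w).-1 alpha w < Ustar g.
  have [/lo_lt//|t1] := ltnP 1 (that w).
  have -> : (that w).-1 = 0%N by lia.
  by apply: le_lt_trans V0w _; rewrite /U utility0.
lra.
Qed.
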